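(* Let $\Sigma$ be a connected surface, $\mathring\Sigma=\Sigma\setminus A$ with $A\subset\Sigma$ countable and dense, and let $p:Z\to\mathring\Sigma$ be a covering projection with $Z$ path connected. Then the degree of $p$ is either finite or countably infinite, and $Z$ is (homeomorphic to) a perforated surface.
   Context: A surface is a paracompact 2-manifold without boundary. A perforated surface is a space of the form $\Sigma'\setminus A'$ where $\Sigma'$ is a connected surface and $A'$ is a countable dense subset of $\Sigma'$. *)

(* Defs.v *)
From HB Require Import structures.
From mathcomp Require Import all_boot all_order all_algebra.
From mathcomp Require Import all_classical all_reals all_analysis.

Set Implicit Arguments.
Unset Strict Implicit.
Unset Printing Implicit Defensive.

Import Order.TTheory GRing.Theory Num.Theory.
Import numFieldNormedType.Exports.

Local Open Scope classical_set_scope.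
Local Open Scope card_scope.
Local Open Scope ring_scope.

(* Subsets regarded as spaces are [set_type], with the initial topology of the
   inclusion; the library's [subspace] lives on the whole ambient type. *)

Definition homeomorphism (X Y : topologicalType) (f : X -> Y) : Prop :=
  continuous f /\ exists2 g : Y -> X, continuous g & cancel f g /\ cancel g f.

Definition homeomorphic (X Y : topologicalType) : Prop :=
  exists f : X -> Y, homeomorphism f.

Definition locally_euclidean (R : realType) (n : nat) (X : topologicalType) :
  Prop :=
  forall x : X, exists U : set X, open U /\ U x /\
    exists2 V : set 'rV[R]_n, open V & homeomorphic (set_type U) (set_type V).

Definition open_cover (X : topologicalType) (C : set (set X)) : Prop :=
  C `<=` open /\ \bigcup_(U in C) U = [set: X].

Definition refines (X : Type) (D C : set (set X)) : Prop :=
  forall V, D V -> exists2 U, C U & V `<=` U.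

Definition locally_finite (X : topologicalType) (D : set (set X)) : Prop :=
  forall x : X, exists2 N, nbhs x N & finite_set [set V | D V /\ V `&` N !=set0].

Definition paracompact (X : topologicalType) : Prop :=
  hausdorff_space X /\
  forall C : set (set X), open_cover C ->
    exists D : set (set X), [/\ open_cover D, refines D C & locally_finite D].

(* Being Hausdorff is part of [paracompact]. *)
Definition surface (R : realType) (X : topologicalType) : Prop :=
  paracompact X /\ locally_euclidean R 2 X.

Definition perforated_surface (R : realType) (X : topologicalType) : Prop :=
  exists (S : topologicalType) (A : set S),
    [/\ surface R S, connected [set: S], countable A, dense A
      & homeomorphic X (set_type (~` A))].

Definition path_connected (R : realType) (X : topologicalType) : Prop :=
  forall x y : X, exists g : R -> X,
    [/\ {within `[0, 1], continuous g}, g 0 = x & g 1 = y].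

Definition maps_homeomorphically (X Y : topologicalType) (f : X -> Y)
    (V : set X) (U : set Y) : Prop :=
  exists2 h : set_type V -> set_type U,
    homeomorphism h & forall v : set_type V, set_val (h v) = f (set_val v).

Definition evenly_covered (Z B : topologicalType) (p : Z -> B) (U : set B) :
  Prop :=
  exists S : set (set Z),
    [/\ forall V, S V -> open V /\ maps_homeomorphically p V U,
        trivIset S id
      & p @^-1` U = \bigcup_(V in S) V].

(* Surjectivity is not required; it is automatic when [B] is connected and [Z]
   is nonempty. *)
Definition covering_projection (Z B : topologicalType) (p : Z -> B) : Prop :=
  continuous p /\
  forall b : B, exists U : set B, [/\ open U, U b & evenly_covered p U].

(* The degree is the common cardinality of all fibres, given here by a set [D]
   representing that cardinal. *)
Definition has_degree (Z B T : Type) (p : Z -> B) (D : set T) : Prop :=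
  forall b : B, p @^-1` [set b] #= D.

(* Main.v *)
Require Import Defs.
From HB Require Import structures.
From mathcomp Require Import all_boot all_order all_algebra.
From mathcomp Require Import all_classical all_reals all_analysis.
From mathcomp Require Import lra.

(** Let [q : Z -> Sigma] be [p] followed by the inclusion. A sheet is an open
    [V] in [Z] that [q] maps bijectively onto [W `\` A], with [W] open in
    [Sigma]. Since [Sigma] is second countable, a sheet meets only countably
    many sheets over a countable cover of the base, so by connectedness
    countably many sheets cover [Z] (Poincare-Volterra); in particular fibres
    are countable, and they all have the same cardinality because [~` A] is
    connected.

    To fill in the missing points, glue the sets [W] along germs of sections:
    the new surface consists of the germs at points [x] of [W] (possibly in [A])
    of sections defined on [W `\` A] and given by the countably many chosen
    sheets. It is locally homeomorphic to [Sigma] and second countable. It is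
    Hausdorff because discs minus a countable set are connected, so that two
    sections over such a set agree everywhere or nowhere. The germs over points
    of [A] form a countable dense set whose complement is [Z]. *)

Set Implicit Arguments.
Unset Strict Implicit.
Unset Printing Implicit Defensive.

Import Order.TTheory GRing.Theory Num.Theory.
Import numFieldNormedType.Exports.

Local Open Scope classical_set_scope.
Local Open Scope card_scope.

(** * General topology *)

Lemma open_local (X : topologicalType) (G : set X) :
  (forall x, G x -> exists O, [/\ open O, O x & O `<=` G]) -> open G.
Proof.
move=> GP; rewrite openE => x /GP[ O [ oO Ox OG]].
by apply: filterS OG _; exact: open_nbhs_nbhs.
Qed.

Lemma open_nbhsP (X : topologicalType) (x : X) (N : set X) :
  nbhs x N -> exists O, [/\ open O, O x & O `<=` N].
Proof. by rewrite nbhsE => -[ O [ oO Ox] ON]; exists O. Qed.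

(** Form suited to clopen arguments: [H] witnesses that [G] is relatively closed in [E], and the two
    ambient open sets need to be disjoint only inside [E]. *)
Lemma connected_openP (X : topologicalType) (E : set X) :
  connected E <-> forall G H : set X, open G -> open H -> E `<=` G `|` H ->
    (forall x, E x -> G x -> H x -> False) -> E `&` G !=set0 -> E `<=` G.
Proof.
split=> [cE G H oG oH EGH GH0 EG0|cE B B0 [C oC BC] [D cD BD]].
  suff EG : E `&` G = E by move=> x Ex; move: (Ex); rewrite -{1}EG => -[].
  apply: cE => //; first by exists G.
  exists (~` H); first exact: open_closedC.
  apply/seteqP; split=> x [Ex].
    by move=> Gx; split=> // Hx; exact: (GH0 x).
  by move=> nHx; split=> //; case: (EGH x Ex).
suff EC : E `<=` C by rewrite BC; exact: setIidl.
apply: (cE C (~` D)) => //.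
- exact: closed_openC.
- move=> x Ex; have [Dx|nDx] := pselect (D x); last by right.
  by left; have : B x by [rewrite BD]; rewrite BC => -[].
- by move=> x Ex Cx; apply; have : B x by [rewrite BC]; rewrite BD => -[].
- by rewrite -BC.
Qed.

(** [C] lies on one side of any separation of [E], and an open set meeting [E] also meets [C], so
    the other side is empty. *)
Lemma connected_between (X : topologicalType) (C E : set X) :
  connected C -> C `<=` E -> E `<=` closure C -> connected E.
Proof.
move=> /connected_openP cC CE EC; apply/connected_openP => G H oG oH EGH GH0.
move=> [x [Ex Gx]].
have CG : C `<=` G.
  apply: (cC _ H) => // [y /CE /EGH //|y /CE|]; first exact: GH0.
  by have [] := EC x Ex G (open_nbhs_nbhs (conj oG Gx)) => y; exists y.
move=> y Ey; have [//|Hy] := EGH y Ey.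
have [z [Cz Hz]] := EC y Ey H (open_nbhs_nbhs (conj oH Hy)).
by have := GH0 z (CE z Cz) (CG z Cz) Hz.
Qed.

(** Start from one member and repeatedly add all members meeting those already reached. Each stage
    is countable. The union of the reached members is open, and the members missing it cover its
    complement, so by connectedness everything is reached. *)
Lemma countable_connected_cover (X : topologicalType) (D : set (set X)) :
  connected [set: X] -> (forall U, D U -> open U /\ U !=set0) ->
  (forall x, exists2 U, D U & U x) ->
  (forall U, D U -> countable [set V | D V /\ V `&` U !=set0]) -> countable D.
Proof.
move=> cX oD covD cD.
have [D0|/set0P/negP] := pselect (D !=set0); last first.
  by rewrite negbK => /eqP ->; exact: countable0.
have [U0 DU0] := D0.
pose E := fix E n := if n is n'.+1 then
  \bigcup_(U in E n') [set V | D V /\ V `&` U !=set0] else [set U0].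
have ED n : E n `<=` D.
  by case: n => [|n] V /=; [move=> ->|move=> [U _ []]].
have cE n : countable (E n).
  elim: n => [|n IH] /=; first exact: countable1.
  by apply: bigcup_countable => // U /ED /cD.
pose G := \bigcup_n \bigcup_(U in E n) U.
have EG U V n : E n U -> D V -> V `&` U !=set0 -> E n.+1 V.
  by move=> EU DV VU; exists U.
have oG : open G.
  by apply: bigcup_open => n _; apply: bigcup_open => U /ED /oD[].
pose H := \bigcup_(V in [set V | D V /\ V `&` G = set0]) V.
have oH : open H by apply: bigcup_open => U [/oD[]].
have step V : D V -> V `&` G !=set0 -> exists n, E n V.
  move=> DV [x [Vx [n _ [U EU Ux]]]]; exists n.+1.
  by apply: EG EU DV _; exists x.
have GT : [set: X] `<=` G.
  move/connected_openP: cX; apply; first exact: oG.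
  - exact: oH.
  - move=> x _; have [V DV Vx] := covD x.
    have [VG|/set0P/negP] := pselect (V `&` G !=set0).
      by have [n EV] := step V DV VG; left; exists n => //; exists V.
    by rewrite negbK => /eqP VG; right; exists V.
  - move=> x _ Gx [V [_ VG] Vx].
    by suff : set0 x by []; rewrite -VG.
  - have [x Ux] := (oD _ DU0).2.
    by exists x; split=> //; exists 0%N => //; exists U0.
apply: (@sub_countable _ _ _ (\bigcup_n E n)); last first.
  by apply: bigcup_countable => //; exact: countableP.
apply: subset_card_le => V DV; have [x Vx] := (oD _ DV).2.
by have [n EV] := step V DV (ex_intro _ x (conj Vx (GT x I))); exists n.
Qed.

(** * Countable bases, the Lindelof property and paracompactness *)

(** The basic sets are open in the ambient space and may leave [G]; this avoids subspace topologies
    and makes restriction to smaller sets immediate. *)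
Definition countable_base_on (X : topologicalType) (G : set X) : Prop :=
  exists2 B : set (set X), countable B & B `<=` open /\
    forall x U, G x -> open U -> U x -> exists V, [/\ B V, V x & V `<=` U].

Lemma countable_base_on_sub (X : topologicalType) (F G : set X) :
  F `<=` G -> countable_base_on G -> countable_base_on F.
Proof.
move=> FG [B cB [oB BP]]; exists B => //; split=> // x U /FG; exact: BP.
Qed.

Lemma countable_base_on_bigcup (X : topologicalType) (I : Type) (D : set I)
    (F : I -> set X) :
  countable D -> (forall i, D i -> countable_base_on (F i)) ->
  countable_base_on (\bigcup_(i in D) F i).
Proof.
move=> cD FP.
have /choice[B BP] i : exists B : set (set X),
    D i -> countable B /\ B `<=` open /\
    forall x U, F i x -> open U -> U x -> exists V, [/\ B V, V x & V `<=` U].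
  have [Di|nDi] := pselect (D i); last by exists set0.
  by have [B cB oB] := FP i Di; exists B.
exists (\bigcup_(i in D) B i).
  by apply: bigcup_countable => // i /BP[].
split=> [V [i /BP[_ [+ _]]]|x U [i Di Fx] oU Ux]; first exact.
have [_ [_ /(_ _ _ Fx oU Ux)[V [BV Vx VU]]]] := BP i Di.
by exists V; split=> //; exists i.
Qed.

(** Choose one member of [C] for each basic set that lies in some member. *)
Lemma lindelof (X : topologicalType) (C : set (set X)) :
  countable_base_on [set: X] -> C `<=` open ->
  exists C', [/\ C' `<=` C, countable C'
    & \bigcup_(U in C) U `<=` \bigcup_(U in C') U].
Proof.
move=> [B cB [oB BP]] oC.
pose B' := [set V | B V /\ exists2 U, C U & V `<=` U].
have /choice[u uP] V : exists U, B' V -> C U /\ V `<=` U.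
  have [[BV [U CU VU]]|] := pselect (B' V); last by exists V.
  by exists U.
exists (u @` B'); split.
- by move=> _ [V /uP[CU _] <-].
- apply: (@sub_countable _ _ _ B'); first exact: card_image_le.
  by apply: sub_countable cB; apply: subset_card_le => V [].
- move=> x [U CU Ux]; have [V [BV Vx VU]] := BP x U I (oC _ CU) Ux.
  have B'V : B' V by split=> //; exists U.
  by exists (u V); [exists V|apply: (uP V B'V).2].
Qed.

Lemma countable_enum (X : Type) (D : set (set X)) : countable D ->
  exists e : nat -> set X,
    (forall n, D (e n) \/ e n = set0) /\ (forall U, D U -> exists n, e n = U).
Proof.
move=> /countable_injP[f injf].
have /choice[e eP] n : exists V, (D V /\ f V = n) \/
    (V = set0 /\ ~ exists2 U, D U & f U = n).
  have [[U DU fU]|nU] := pselect (exists2 U, D U & f U = n).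
    by exists U; left.
  by exists set0; right.
exists e; split=> [n|U DU]; first by have [[]|[]] := eP n; [left|right].
exists (f U); have [[De fe]|[_ []]] := eP (f U); last by exists U.
by apply: injf fe; rewrite inE.
Qed.

(** Regularity and the Lindelof property give a sequence of open sets [N n] covering the space, with
    closures inside members [u n] of [C]; the refinement subtracts from each [u n] the earlier
    closures. *)
Lemma second_countable_paracompact (X : topologicalType) :
  hausdorff_space X -> countable_base_on [set: X] ->
  (forall (x : X) U, open U -> U x ->
    exists N, [/\ open N, N x & closure N `<=` U]) ->
  paracompact X.
Proof.
move=> hX bX regX; split=> // C [oC covC].
pose S := [set N : set X | open N /\ exists2 U, C U & closure N `<=` U].
have [S' [S'S cS' covS']] := @lindelof X S bX (fun N SN => proj1 SN).
have {cS'}[N [NS NP]] := countable_enum cS'.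
have covN x : exists n, N n x.
  have [U CU Ux] : (\bigcup_(U in C) U) x by rewrite covC.
  have [M [oM Mx MU]] := regX x U (oC _ CU) Ux.
  have [|M' /NP[n <-] nx] := covS' x; last by exists n.
  by exists M => //; split=> //; exists U.
have /choice[u uP] n : exists U, closure (N n) `<=` U /\ (C U \/ U = set0).
  have [/S'S[_ [U CU NU]]|->] := NS n; first by exists U; split=> //; left.
  by exists set0; rewrite closure0; split=> //; right.
have oN n : open (N n) by have [/S'S[]|->] := NS n => //; exact: open0.
(* Only closures of earlier members are removed, so [N n] meets no [v m]
   with [m > n]; this gives local finiteness without a shrinking argument. *)
pose v n := u n `\` \bigcup_(m in `I_n) closure (N m).
have ov n : C (u n) -> open (v n).
  move=> Cu; apply: openI; first exact: oC.
  apply: closed_openC; apply: closed_bigcup; first exact: finite_II.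
  by move=> m _; exact: closed_closure.
exists [set v n | n in [set n | C (u n)]]; split.
- split; first by move=> _ [n Cu <-]; exact: ov.
  apply/seteqP; split=> // x _.
  (* For the least [n] with [x] in [u n], no earlier closure contains [x], since the closure of
     [N m] lies in [u m]. *)
  have ex : exists n, `[< u n x >].
    have [n Nx] := covN x; exists n; apply/asboolP.
    by apply: (uP n).1; exact: subset_closure.
  case: (ex_minnP ex) => n /asboolP ux minn.
  have Cu : C (u n) by have [_ [//|u0]] := uP n; rewrite u0 in ux.
  exists (v n); first by exists n.
  split=> // -[m /= mn] /(uP m).1 umx.
  by move: (minn m); rewrite leqNgt mn => /(_ (asboolT umx)).
- by move=> _ [n Cu <-]; exists (u n) => // x [].
- move=> x; have [n Nx] := covN x.
  exists (N n); first exact: open_nbhs_nbhs.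
  apply: (@sub_finite_set _ _ (v @` `I_n.+1)).
    move=> _ [[m Cu <-] [y [[uy nvy] Ny]]]; exists m => //=.
    rewrite ltnS leqNgt; apply/negP => nm.
    by apply: nvy; exists n => //; exact: subset_closure.
  by apply: finite_image; exact: finite_II.
Qed.

(** * Homeomorphisms between open subsets *)

(** The two maps are total on the ambient spaces, with arbitrary values off [U] and [V], so that
    charts compose and restrict without subtypes. *)
Record open_patch (X Y : topologicalType) (U : set X) (V : set Y)
    (f : X -> Y) (g : Y -> X) : Prop := OpenPatch {
  patch_dom_open : open U;
  patch_cod_open : open V;
  patch_fP : forall x, U x -> V (f x) /\ g (f x) = x;
  patch_gP : forall y, V y -> U (g y) /\ f (g y) = y;
  patch_f_open : forall O, open O -> open (U `&` f @^-1` O);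
  patch_g_open : forall O, open O -> open (V `&` g @^-1` O) }.

Lemma open_patch_sym (X Y : topologicalType) (U : set X) (V : set Y) f g :
  open_patch U V f g -> open_patch V U g f.
Proof. by case. Qed.

Lemma open_patch_comp (X Y T : topologicalType) (U : set X) (V V' : set Y)
    (W : set T) f g f' g' :
  open_patch U V f g -> open_patch V' W f' g' ->
  open_patch (U `&` f @^-1` V') (W `&` g' @^-1` V) (f' \o f) (g \o g').
Proof.
move=> [oU oV fP gP fo go] [oV' oW fP' gP' fo' go']; split.
- exact: fo.
- exact: go'.
- move=> x [Ux V'x] /=; have [Vfx gfx] := fP x Ux; have [Wf gf'] := fP' _ V'x.
  by rewrite gf'.
- move=> y [Wy Vy] /=; have [Vfx gfx] := gP' y Wy; have [Wf gf'] := gP _ Vy.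
  by rewrite gf'.
- move=> O oO; have := fo _ (fo' _ oO); congr open.
  by apply/seteqP; split=> x /=; [move=> [? []]|move=> [[]]].
- move=> O oO; have := go' _ (go _ oO); congr open.
  by apply/seteqP; split=> x /=; [move=> [? []]|move=> [[]]].
Qed.

Lemma open_patch_homeomorphic (X Y : topologicalType) (U : set X) (V : set Y)
    f g : open_patch U V f g -> homeomorphic (set_type U) (set_type V).
Proof.
move=> [oU oV fP gP fo go].
have fV (x : set_type U) : f (set_val x) \in V.
  by rewrite inE; exact: (fP _ (set_valP x)).1.
have gU (y : set_type V) : g (set_val y) \in U.
  by rewrite inE; exact: (gP _ (set_valP y)).1.
exists (fun x => SigSub (fV x)); split.
  apply/continuousP => G [ O oO <-].
  exists (U `&` f @^-1` O); first exact: fo.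
  apply/seteqP; split=> x /=; first by move=> [].
  by move=> Ox; split=> //; exact: set_valP.
exists (fun y => SigSub (gU y)).
  apply/continuousP => G [ O oO <-].
  exists (V `&` g @^-1` O); first exact: go.
  apply/seteqP; split=> x /=; first by move=> [].
  by move=> Ox; split=> //; exact: set_valP.
split=> x; apply: val_inj => /=.
  by rewrite (fP _ (set_valP x)).2.
by rewrite (gP _ (set_valP x)).2.
Qed.

Lemma homeomorphic_open_patch (X Y : topologicalType) (U : set X) (V : set Y) :
  U !=set0 -> open U -> open V -> homeomorphic (set_type U) (set_type V) ->
  exists f g, open_patch U V f g.
Proof.
move=> [x0 Ux0] oU oV [h [ch [k ck [hk kh]]]].
(* The point [u0] and its image serve as default values when the maps are extended beyond [U] and
   [V]. *)
pose u0 : set_type U := SigSub (mem_set Ux0).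
pose f x := set_val (h (insubd u0 x)).
pose g y := set_val (k (insubd (h u0) y)).
have insU x (Ux : U x) : insubd u0 x = SigSub (mem_set Ux).
  by apply: val_inj; rewrite val_insubd mem_set.
have insV x (Vx : V x) : insubd (h u0) x = SigSub (mem_set Vx).
  by apply: val_inj; rewrite val_insubd mem_set.
exists f, g; split=> //.
- move=> x Ux; split; first exact: set_valP.
  by rewrite /f /g valKd hk insU.
- move=> y Vy; split; first exact: set_valP.
  by rewrite /f /g valKd kh insV.
- move=> O oO.
  have /continuousP/(_ (set_val @^-1` O))[|G oG GE] := ch; first by exists O.
  have -> : U `&` f @^-1` O = U `&` G; last exact: openI.
  apply/seteqP; split=> x [Ux xO]; split=> //.
    have : (set_val @^-1` G) (SigSub (mem_set Ux)) by rewrite GE /= -insU.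
    by [].
  have : (set_val @^-1` G) (SigSub (mem_set Ux)) by [].
  by rewrite GE /= -insU.
- move=> O oO.
  have /continuousP/(_ (set_val @^-1` O))[|G oG GE] := ck; first by exists O.
  have -> : V `&` g @^-1` O = V `&` G; last exact: openI.
  apply/seteqP; split=> x [Ux xO]; split=> //.
    have : (set_val @^-1` G) (SigSub (mem_set Ux)) by rewrite GE /= -insV.
    by [].
  have : (set_val @^-1` G) (SigSub (mem_set Ux)) by [].
  by rewrite GE /= -insV.
Qed.

Lemma locally_euclideanP (R : realType) (n : nat) (X : topologicalType) :
  locally_euclidean R n X <->
  forall x : X, exists U (V : set 'rV[R]_n) f g, U x /\ open_patch U V f g.
Proof.
split=> eX x; last first.
  have [U [V [f [g [Ux P]]]]] := eX x.
  exists U; split; first exact: patch_dom_open P.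
  split=> //; exists V; first exact: patch_cod_open P.
  exact: open_patch_homeomorphic P.
have [U [oU [Ux [V oV h]]]] := eX x.
have [|f [g P]] := homeomorphic_open_patch _ oU oV h; first by exists x.
by exists U, V, f, g.
Qed.

Lemma open_patch_within (X Y : topologicalType) (U : set X) (V : set Y) f g :
  open_patch U V f g -> {within U, continuous f}.
Proof.
move=> P; apply: continuous_in_subspaceT => x /[1!inE] Ux.
move=> N /open_nbhsP[ O [oO Ox ON]].
apply: (@filterS _ _ _ (U `&` f @^-1` O)); first by move=> y [_ /ON].
by apply: open_nbhs_nbhs; split=> //; exact: patch_f_open P _ oO.
Qed.

Lemma open_patch_compact (X Y : topologicalType) (U : set X) (V : set Y) f g K :
  open_patch U V f g -> K `<=` U -> compact K -> compact (f @` K).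
Proof.
move=> P KU; apply: continuous_compact.
exact: continuous_subspaceW KU (open_patch_within P).
Qed.

Lemma open_patch_connected (X Y : topologicalType) (U : set X) (V : set Y)
    f g K :
  open_patch U V f g -> K `<=` U -> connected K -> connected (f @` K).
Proof.
move=> P KU cK; apply: connected_continuous_connected => //.
exact: continuous_subspaceW KU (open_patch_within P).
Qed.

Lemma open_patch_countable_base (X Y : topologicalType) (U : set X)
    (V : set Y) f g :
  open_patch U V f g -> countable_base_on V -> countable_base_on U.
Proof.
move=> [oU oV fP gP fo go] [B cB [oB BP]].
exists [set U `&` f @^-1` W | W in B].
  by apply: sub_countable cB; exact: card_image_le.
split=> [_ [W BW <-]|x O Ux oO Ox]; first by apply: fo; exact: oB.
have [Vfx gfx] := fP x Ux.
have [||W [BW Wx WO]] := BP (f x) (V `&` g @^-1` O) Vfx; first exact: go.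
  by split=> //=; rewrite gfx.
exists (U `&` f @^-1` W); split=> //; first by exists W.
by move=> y [Uy /WO[_ /=]]; rewrite (fP y Uy).2.
Qed.

(** * Euclidean space *)

Section euclidean_space.
Local Open Scope ring_scope.

Lemma rV_ballP (R : realType) (n : nat) (v w : 'rV[R]_n) (e : R) : 0 < e ->
  ball v e w <-> forall j, `|v ord0 j - w ord0 j| < e.
Proof.
move=> e0; split=> [[_ vw] j|vw]; first exact: vw.
by split=> // i j; rewrite (ord1 i); exact: vw.
Qed.

Lemma rV_ball_sub (R : realType) (n : nat) (v : 'rV[R]_n) (O : set 'rV[R]_n) :
  open O -> O v -> exists2 e : R, 0 < e & ball v e `<=` O.
Proof.
move=> oO Ov; have /nbhs_ballP[e /= e0 eO] : nbhs v O by exact: open_nbhs_nbhs.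
by exists e.
Qed.

Lemma rV_countable_base (R : realType) (n : nat) :
  countable_base_on [set: 'rV[R]_n].
Proof.
pose b (x : {ffun 'I_n -> rat} * nat) : set 'rV[R]_n :=
  ball (\row_j ratr (x.1 j) : 'rV[R]_n) x.2.+1%:R^-1.
exists (range b).
  by apply: sub_countable (card_image_le _ _) _; exact: countableP.
split=> [_ [x _ <-]|v O _ oO Ov]; first exact: ball_open.
have [e e0 eO] := rV_ball_sub oO Ov.
(* With radius below [e / 2], a ball containing [v] lies in the ball of radius [e] about [v]. *)
have [k k0] : exists k : nat, k.+1%:R^-1 < e / 2.
  have e20 : 0 < e / 2 by rewrite divr_gt0.
  have [k _ kP] := near_infty_natSinv_lt (PosNum e20).
  by exists k; apply: (kP k) => /=.
have /choice[q qP] (j : 'I_n) : exists q : rat,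
    `|v ord0 j - ratr q| < k.+1%:R^-1.
  have [|q] := @rat_in_itvoo _ (v ord0 j - k.+1%:R^-1) (v ord0 j + k.+1%:R^-1).
    by rewrite ltrD2l (@lt_trans _ _ 0) ?oppr_lt0 ?invr_gt0.
  rewrite in_itv /= => /andP[q1 q2]; exists q.
  by rewrite ltr_distl ltrBlDr q2 -ltrBlDr q1.
exists (b ([ffun j => q j], k)); split; first by exists ([ffun j => q j], k).
  by apply/rV_ballP => //= j; rewrite mxE ffunE distrC; exact: qP.
move=> w /rV_ballP bw; apply: eO; apply/rV_ballP => // j.
have {}bw : `|ratr (q j) - w ord0 j| < k.+1%:R^-1.
  by have := bw _ j; rewrite mxE ffunE; apply.
rewrite (splitr e) -(subrKA (ratr (q j))).
apply: le_lt_trans (ler_normD _ _) _; apply: ltrD; apply: lt_trans k0 => //.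
Qed.

Lemma rV_compact_nbhs (R : realType) (n : nat) (v : 'rV[R]_n)
    (O : set 'rV[R]_n) :
  open O -> O v -> exists K, [/\ compact K, nbhs v K & K `<=` O].
Proof.
move=> oO Ov; have [e e0 eO] := rV_ball_sub oO Ov.
have e20 : 0 < e / 2 by rewrite divr_gt0.
have sub : closed_ball v (e / 2) `<=` ball v e by exact: subset_closure_half.
exists (closed_ball v (e / 2)); split.
- apply: bounded_closed_compact; last exact: closed_ball_closed.
  exists (`|v| + e); split; first exact: num_real.
  move=> M eM w /sub; rewrite -ball_normE /= => vw.
  apply: ltW; apply: lt_trans eM; rewrite -(subrK v w) addrC.
  by apply: le_lt_trans (ler_normD _ _) _; rewrite ltrD2l distrC.
- by apply/nbhs_closedballP; exists (PosNum e20).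
- exact: subset_trans sub eO.
Qed.

(** Otherwise the interval lies in [C] and has Lebesgue measure zero, whereas its measure is
    [b - a]. *)
Lemma real_avoid_countable (R : realType) (C : set R) (a b : R) :
  countable C -> a < b -> exists s, [/\ a < s, s < b & ~ C s].
Proof.
move=> cC ab; apply: contrapT => nex.
have sC : `]a, b[%classic `<=` C.
  move=> s; rewrite /= in_itv /= => /andP[as_ sb].
  by apply: contrapT => nCs; apply: nex; exists s.
have : lebesgue_measure `]a, b[%classic = 0%E :> \bar R.
  apply: countable_lebesgue_measure0; apply: sub_countable cC.
  exact: subset_card_le.
rewrite lebesgue_measure_itv /= lte_fin ab => /eqP.
by rewrite -EFinB eqe subr_eq0 => /eqP ba; rewrite ba ltxx in ab.
Qed.

Lemma connected_ball (R : realType) (a e : R) : connected (ball a e).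
Proof.
by rewrite ball_itv; apply/connected_intervalP; exact: interval_is_interval.
Qed.


Section square.
Variable R : realType.
Implicit Types (s t e : R) (v w : 'rV[R]_2).

Let pt s t : 'rV[R]_2 := \row_j (if j == ord0 then s else t).

Let pt_ball v e s t : 0 < e ->
  ball v e (pt s t) <-> ball (v ord0 ord0) e s /\ ball (v ord0 ord_max) e t.
Proof.
move=> e0; split=> [/rV_ballP vst|[vs vt]].
  by split; [have := vst e0 ord0|have := vst e0 ord_max]; rewrite mxE.
apply/rV_ballP => // j; rewrite mxE.
have [->//|jn0] := eqVneq j ord0.
by have -> : j = ord_max by apply: val_inj; case: j jn0 => -[|[]].
Qed.

Let pt_eta w : w = pt (w ord0 ord0) (w ord0 ord_max).
Proof.
apply/rowP => j; rewrite mxE; have [->//|jn0] := eqVneq j ord0.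
by congr (w _ _); apply: val_inj; case: j jn0 => -[|[]].
Qed.

Let pt_continuousl t : continuous (pt^~ t).
Proof.
move=> s; apply/cvg_ballP => e e0; exists e => // s' ss'.
by apply/pt_ball => //; rewrite !mxE; split=> //; exact: ballxx.
Qed.

Let pt_continuousr s : continuous (pt s).
Proof.
move=> t; apply/cvg_ballP => e e0; exists e => // t' tt'.
by apply/pt_ball => //; rewrite !mxE; split=> //; exact: ballxx.
Qed.

Let ball_avoid (C : set R) (a b d e : R) : countable C -> 0 < e -> 0 < d ->
  ball a d b -> exists s, [/\ ball a d s, ball b e s & ~ C s].
Proof.
move=> cC e0 d0; rewrite /ball /= ltr_distl => /andP[bd db].
have [|s [s1 s2 Cs]] :=
  (* Points just to the left of [b] lie in both balls. *)
  @real_avoid_countable R C (Num.max (a - d) (b - e)) b cC.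
  by rewrite gt_max; apply/andP; split; lra.
exists s; split=> //; rewrite /ball /= ltr_distl.
all: move: s1; rewrite gt_max => /andP[]; lra.
Qed.

(* A vertical segment avoiding the countable set, together with all the
   horizontal segments avoiding it, is connected and dense. *)
Lemma connected_ball_setD_countable (A : set 'rV[R]_2) v e :
  countable A -> 0 < e -> connected (ball v e `\` A).
Proof.
move=> cA e0.
(* [C0] and [C1] are the coordinate projections of [A]: a vertical line with abscissa outside [C0],
   or a horizontal one with ordinate outside [C1], misses [A]. *)
pose C0 := (fun w => w ord0 ord0) @` A.
pose C1 := (fun w => w ord0 ord_max) @` A.
have cC0 : countable C0 by apply: sub_countable cA; exact: card_image_le.
have cC1 : countable C1 by apply: sub_countable cA; exact: card_image_le.
have [s0 [bs0 _ Cs0]] :=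
  @ball_avoid C0 _ _ _ _ cC0 e0 e0 (ballxx (v ord0 ord0) e0).
pose L := pt s0 @` ball (v ord0 ord_max) e.
pose H t := pt^~ t @` ball (v ord0 ord0) e.
pose good := [set t | ball (v ord0 ord_max) e t /\ ~ C1 t].
have LA : L `<=` ball v e `\` A.
  move=> _ [t bt <-]; split; first by apply/pt_ball.
  by move=> Aw; apply: Cs0; exists (pt s0 t); rewrite ?mxE.
have HA t : good t -> H t `<=` ball v e `\` A.
  move=> [bt Ct] _ [s bs <-]; split; first by apply/pt_ball.
  by move=> Aw; apply: Ct; exists (pt s t); rewrite ?mxE.
apply: (@connected_between _ (\bigcup_(t in good) (L `|` H t))).
- apply: bigcup_connected.
    exists (pt s0 (v ord0 ord_max)) => t _; left.
    by exists (v ord0 ord_max) => //; exact: ballxx.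
  move=> t [bt Ct]; apply: connectedU.
  + by exists (pt s0 t); split; [exists t|exists s0].
  + apply: connected_continuous_connected; first exact: connected_ball.
    exact: continuous_subspaceT.
  + apply: connected_continuous_connected; first exact: connected_ball.
    exact: continuous_subspaceT.
- by move=> w [t gt [/LA|/HA]]; [|exact].
(* Density: keep the first coordinate of [w] and move the second slightly, off [C1]. *)
- move=> w [bw nAw] N /nbhs_ballP[d /= d0 dN].
  move: bw; rewrite {1}(pt_eta w) => /pt_ball -/(_ e0)[bw0 bw1].
  have [t [bt wt Ct]] := @ball_avoid C1 _ _ _ _ cC1 d0 e0 bw1.
  exists (pt (w ord0 ord0) t); split.
    by exists t => //; right; exists (w ord0 ord0).
  by apply: dN; apply/pt_ball => //; split=> //; exact: ballxx.
Qed.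

Lemma ball_setD_countable_neq0 (A : set 'rV[R]_2) v e : countable A -> 0 < e ->
  ball v e `\` A !=set0.
Proof.
move=> cA e0; pose C0 := (fun w => w ord0 ord0) @` A.
have cC0 : countable C0 by apply: sub_countable cA; exact: card_image_le.
have [s [bs _ Cs]] :=
  @ball_avoid C0 _ _ _ _ cC0 e0 e0 (ballxx (v ord0 ord0) e0).
exists (pt s (v ord0 ord_max)); split.
  by apply/pt_ball => //; split=> //; exact: ballxx.
by move=> As; apply: Cs; exists (pt s (v ord0 ord_max)); rewrite ?mxE.
Qed.

End square.

End euclidean_space.

(** * Locally Euclidean spaces *)

Lemma finite_meet_compact (X : topologicalType) (D : set (set X)) (K : set X) :
  locally_finite D -> compact K -> finite_set [set V | D V /\ V `&` K !=set0].
Proof.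
move=> lfD /compact_near_coveringP cK.
(* Compactness is applied to the filter of families containing a given finite family; each point
   holds eventually because of local finiteness, so one finite family serves all of [K]. *)
pose F := filter_from [set E : set (set X) | finite_set E]
  (fun E => [set E' | E `<=` E']).
have FF : Filter F.
  apply: filter_from_filter; first by exists set0; exact: finite_set0.
  move=> E1 E2 f1 f2; exists (E1 `|` E2); first by rewrite /= finite_setU.
  by move=> E' E12; split=> V EV; apply: E12; [left|right].
have [x Kx|E fE KE] := cK _ F (fun E x => forall V, D V -> V x -> E V) FF.
  have [N nN fN] := lfD x.
  exists (N, [set E | [set V | D V /\ V `&` N !=set0] `<=` E]).
    by split=> //; exists [set V | D V /\ V `&` N !=set0].
  by move=> [y E] [/= Ny NE] V DV Vy; apply: NE; split=> //; exists y.
apply: sub_finite_set fE => V [DV [x [Vx Kx]]].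
exact: (KE E (fun _ => id) x Kx).
Qed.

Section locally_euclidean.
Variables (R : realType) (n : nat) (X : topologicalType).
Hypothesis eX : locally_euclidean R n X.

Lemma locally_euclidean_compact_nbhs (x : X) (O : set X) : open O -> O x ->
  exists K, [/\ compact K, nbhs x K & K `<=` O].
Proof.
move=> oO Ox; have /locally_euclideanP/(_ x)[U [V [f [g [Ux P]]]]] := eX.
have [Vfx gfx] := patch_fP P Ux.
have oO' : open (V `&` g @^-1` O) by exact: patch_g_open P _ oO.
have [|K [cK nK KO]] := rV_compact_nbhs oO' (v := f x).
  by split=> //=; rewrite gfx.
exists (g @` K); split.
- by apply: open_patch_compact (open_patch_sym P) _ cK => y /KO[].
- have [N [oN Nx NK]] := open_nbhsP nK.
  apply: (@filterS _ _ _ (U `&` f @^-1` N)).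
    by move=> y [Uy /NK Ky]; exists (f y) => //; exact: (patch_fP P Uy).2.
  by apply: open_nbhs_nbhs; split=> //; exact: patch_f_open P _ oN.
- by move=> _ [y /KO[_ gy] <-].
Qed.

Lemma locally_euclidean_regular : hausdorff_space X ->
  forall (x : X) U, open U -> U x ->
    exists N, [/\ open N, N x & closure N `<=` U].
Proof.
move=> hX x U oU Ux.
have [K [cK nK KU]] := locally_euclidean_compact_nbhs oU Ux.
have [N [oN Nx NK]] := open_nbhsP nK.
exists N; split=> //; apply: subset_trans KU.
have /closure_id -> : closed K by exact: compact_closed.
exact: closureS.
Qed.

Lemma locally_euclidean_countable_base (x : X) :
  exists U, [/\ open U, U x & countable_base_on U].
Proof.
have /locally_euclideanP/(_ x)[U [V [f [g [Ux P]]]]] := eX.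
exists U; split=> //; first exact: patch_dom_open P.
apply: (open_patch_countable_base P).
by apply: countable_base_on_sub (rV_countable_base R n).
Qed.

(** Take a locally finite refinement of the cover by open sets that have a countable base and lie in
    a compact set. Each member meets only finitely many others, so by connectedness there are
    countably many members, and their bases are put together. *)
Lemma paracompact_connected_countable_base :
  paracompact X -> connected [set: X] -> countable_base_on [set: X].
Proof.
move=> [hX pX] cX.
pose C := [set U : set X | [/\ open U, countable_base_on U &
  exists2 K, compact K & U `<=` K]].
have [|D [[oD covD] rD lfD]] := pX C.
  split; first by move=> U [].
  apply/seteqP; split=> // x _.
  have [U [oU Ux bU]] := locally_euclidean_countable_base x.
  have [K [cK nK KU]] := locally_euclidean_compact_nbhs oU Ux.
  have [N [oN Nx NK]] := open_nbhsP nK.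
  exists N => //; split=> //; last by exists K.
  by apply: countable_base_on_sub bU; exact: subset_trans KU.
pose D' := [set V | D V /\ V !=set0].
have covD' x : exists2 U, D' U & U x.
  have [U DU Ux] : (\bigcup_(U in D) U) x by rewrite covD.
  by exists U => //; split=> //; exists x.
have cD' : countable D'.
  apply: (countable_connected_cover cX) => // [U [/oD]//|U [DU _]].
  have [W [_ _ [K cK WK]] UW] := rD U DU.
  have UK : U `<=` K by exact: subset_trans WK.
  apply: finite_set_countable.
  apply: sub_finite_set (finite_meet_compact lfD cK).
  by move=> V [[DV _] [x [Vx Ux]]]; split=> //; exists x; split=> //; exact: UK.
apply: (@countable_base_on_sub _ _ (\bigcup_(U in D') U)).
  by move=> x _; have [U D'U Ux] := covD' x; exists U.
apply: countable_base_on_bigcup => // U [/rD[W [_ bW _] UW] _].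
exact: countable_base_on_sub bW.
Qed.

End locally_euclidean.

(** * Removing a countable set from a 2-dimensional locally Euclidean space *)

Section plane.
Variables (R : realType) (X : topologicalType) (A : set X).
Hypotheses (eX : locally_euclidean R 2 X) (cA : countable A).

Lemma connected_nbhs_setD_countable (x : X) (O : set X) : open O -> O x ->
  exists D, [/\ open D, D x, D `<=` O, connected (D `\` A) & D `\` A !=set0].
Proof.
move=> oO Ox; have /locally_euclideanP/(_ x)[U [V [f [g [Ux P]]]]] := eX.
have [Vfx gfx] := patch_fP P Ux.
have oO' : open (V `&` g @^-1` O) by exact: patch_g_open P _ oO.
have [|e e0 eO] := rV_ball_sub oO' (v := f x).
  by split=> //=; rewrite gfx.
(* [A'] is [A] read in the chart; it is countable, so a ball minus [A'] is connected and can be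
   carried back. *)
pose A' := V `&` g @^-1` A.
have cA' : countable A'.
  apply: (@sub_countable _ _ _ (f @` A)).
    apply: subset_card_le => y [Vy Ay]; exists (g y) => //.
    exact: (patch_gP P Vy).2.
  by apply: sub_countable cA; exact: card_image_le.
have bV : ball (f x) e `<=` V by move=> y /eO[].
have DE : (U `&` f @^-1` ball (f x) e) `\` A = g @` (ball (f x) e `\` A').
  apply/seteqP; split=> [y [[Uy bfy] Ay]|_ [y [bfy Ay] <-]].
    have gfy := (patch_fP P Uy).2; exists (f y) => //; split=> //.
    by move=> [_ /=]; rewrite gfy.
  have Vy := bV _ bfy; have [Ugy fgy] := patch_gP P Vy.
  by split; [split=> //=; rewrite fgy|move=> Agy; apply: Ay].
exists (U `&` f @^-1` ball (f x) e); split.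
- by apply: patch_f_open P _ _; exact: ball_open.
- by split=> //=; exact: ballxx.
- by move=> y [Uy /eO[_ /=]]; rewrite (patch_fP P Uy).2.
- rewrite DE; apply: open_patch_connected (open_patch_sym P) _ _.
    by move=> y [/bV].
  exact: connected_ball_setD_countable.
- rewrite DE; have [y yP] := ball_setD_countable_neq0 (f x) cA' e0.
  by exists (g y); exists y.
Qed.

Lemma setD_countable_neq0 (G : set X) : open G -> G !=set0 -> G `\` A !=set0.
Proof.
move=> oG [x Gx].
have [D [_ _ DG _ [y [Dy Ay]]]] := connected_nbhs_setD_countable oG Gx.
by exists y; split=> //; exact: DG.
Qed.

(** A separation of the complement extends to [X]: call a point good for a side if some
    neighbourhood of it lies in that side off [A]. A neighbourhood connected off [A] makes every
    point good for one side, and no point is good for both. *)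
Lemma connected_setC_countable : connected [set: X] -> connected (~` A).
Proof.
move=> cX; apply/connected_openP => G H oG oH AGH GH [x0 [Ax0 Gx0]].
pose good E := [set x : X | exists D, [/\ open D, D x & D `\` A `<=` E]].
have ogood E : open (good E).
  apply: open_local => x [D [oD Dx DE]]; exists D; split=> //.
  by move=> y Dy; exists D.
have clash : good G `&` good H = set0.
  apply/seteqP; split=> // x [[D [oD Dx DG]] [D' [oD' D'x DH]]].
  have [|y [[Dy D'y] Ay]] := @setD_countable_neq0 (D `&` D') (openI oD oD').
    by exists x.
  by have := GH y Ay (DG y (conj Dy Ay)) (DH y (conj D'y Ay)).
have goodT x : (good G `|` good H) x.
  have [D [oD Dx _ cD [y [Dy Ay]]]] :=
    connected_nbhs_setD_countable openT (I : setT x).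
  have [Gy|Hy] := AGH y Ay.
    left; exists D; split=> //; apply: ((connected_openP _).1 cD G H) => //.
    + by move=> z [_ /AGH].
    + by move=> z [_]; exact: GH.
    + by exists y.
  right; exists D; split=> //; apply: ((connected_openP _).1 cD H G) => //.
  + by move=> z [_ /AGH]; rewrite setUC.
  + by move=> z [_ Az] Hz Gz; exact: (GH z).
  + by exists y.
have goodG : [set: X] `<=` good G.
  apply: ((connected_openP _).1 cX (good G) (good H)) => //.
  - by move=> x _ gG gH; have : (good G `&` good H) x by []; rewrite clash.
  - by exists x0; split=> //; exists G; split=> // x [].
move=> y Ay; have [//|Hy] := AGH y Ay.
have : (good G `&` good H) y.
  by split; [exact: goodG|exists H; split=> // z []].
by rewrite clash.
Qed.

End plane.

(** * Filling in the missing points *)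

(** [W] keeps its points of [A], which [q] misses on [V]: these are the places to be filled in. *)
Definition sheet (Sigma Z : topologicalType) (A : set Sigma) (q : Z -> Sigma)
    (V : set Z) (W : set Sigma) : Prop :=
  [/\ open V, open W, forall y z, V y -> V z -> q y = q z -> y = z
    & q @` V = W `\` A].

Definition germ (Sigma Z : topologicalType) (q : Z -> Sigma) (V : set Z)
    (x : Sigma) : set (set Z) :=
  [set P | exists N, [/\ open N, N x & V `&` q @^-1` N `<=` P]].

Lemma germ_eqP (Sigma Z : topologicalType) (q : Z -> Sigma) (V V' : set Z)
    (x : Sigma) :
  germ q V x = germ q V' x <->
  exists N, [/\ open N, N x & V `&` q @^-1` N = V' `&` q @^-1` N].
Proof.
split=> [gVV'|[N [oN Nx VV']]].
  (* Each set belongs to its own germ, hence to the other one, which bounds both traces. *)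
  have : germ q V x V by exists setT; split=> //; exact: openT.
  have : germ q V' x V' by exists setT; split=> //; exact: openT.
  rewrite {1}gVV' -{1}gVV' => -[N1 [oN1 N1x V1]] [N2 [oN2 N2x V2]].
  exists (N1 `&` N2); split=> //; first exact: openI.
  by apply/seteqP; split=> y [Vy [y1 y2]]; split=> //; [exact: V1|exact: V2].
have sub U U' :
    U `&` q @^-1` N = U' `&` q @^-1` N -> germ q U x `<=` germ q U' x.
  move=> UU' P [M [oM Mx UP]]; exists (N `&` M); split=> //; first exact: openI.
  move=> y [U'y [Ny My]]; apply: UP; split=> //.
  by have : (U' `&` q @^-1` N) y by []; rewrite -UU' => -[].
by apply/seteqP; split; exact: sub.
Qed.

(* The points over [x] are the germs at [x] of sections [W V `\` A -> Z], each
   represented by its image [V] and recorded as the trace on [V] of the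
   neighbourhoods of [x]; the representing sheets are taken in [D]. *)
Record germ_space (Sigma Z : topologicalType) (q : Z -> Sigma)
    (D : set (set Z)) (W : set Z -> set Sigma) : Type := GermPoint {
  base_pt : Sigma;
  germ_at : set (set Z);
  germ_spaceP : exists V, [/\ D V, W V base_pt & germ_at = germ q V base_pt] }.

Arguments base_pt {Sigma Z q D W} _.
Arguments germ_at {Sigma Z q D W} _.

(** * The topology on the space of germs *)

Section germ_space_topology.
Variables (Sigma Z : topologicalType) (q : Z -> Sigma).
Variables (D : set (set Z)) (W : set Z -> set Sigma).

Local Notation T := (germ_space q D W).

Definition germ_chart (V : set Z) : set T :=
  [set s | W V (base_pt s) /\ germ_at s = germ q V (base_pt s)].

Lemma germ_space_eq (s t : T) :
  base_pt s = base_pt t -> germ_at s = germ_at t -> s = t.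
Proof.
case: s t => [x g P] [y h Q] /= xy gh; subst y h.
by congr GermPoint; exact: Prop_irrelevance.
Qed.

Lemma germ_chart_inj V (s t : T) :
  germ_chart V s -> germ_chart V t -> base_pt s = base_pt t -> s = t.
Proof.
by move=> [_ gs] [_ gt] st; apply: germ_space_eq; rewrite // gs gt st.
Qed.

(** The topology coherent with the charts: a set is open when its trace on every chart is open in
    the coordinate [base_pt]. *)
Definition germ_open (G : set T) : Prop :=
  forall V s, D V -> G s -> germ_chart V s ->
    exists N, [/\ open N, N (base_pt s)
      & germ_chart V `&` base_pt @^-1` N `<=` G].

Lemma germ_openT : germ_open setT.
Proof. by move=> V s _ _ _; exists setT; split=> //; exact: openT. Qed.

Lemma germ_openI : setI_closed germ_open.
Proof.
move=> G H oG oH V s DV [Gs Hs] Vs.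
have [N [oN Ns NG]] := oG V s DV Gs Vs; have [M [oM Ms MH]] := oH V s DV Hs Vs.
exists (N `&` M); split=> //; first exact: openI.
by move=> t [Vt [Nt Mt]]; split; [exact: NG|exact: MH].
Qed.

Lemma germ_open_bigU (I : Type) (f : I -> set T) :
  (forall i, germ_open (f i)) -> germ_open (\bigcup_i f i).
Proof.
move=> of_ V s DV [i _ fs] Vs; have [N [oN Ns Nf]] := of_ i V s DV fs Vs.
by exists N; split=> // t /Nf ft; exists i.
Qed.

HB.instance Definition _ := gen_eqMixin T.
HB.instance Definition _ := gen_choiceMixin T.
HB.instance Definition _ :=
  @isOpenTopological.Build T germ_open germ_openT germ_openI germ_open_bigU.

End germ_space_topology.

(** * The space of germs as a surface containing the covering space *)

Section completion.
Variables (R : realType) (Sigma Z : topologicalType) (A : set Sigma).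
Variables (q : Z -> Sigma) (D : set (set Z)) (W : set Z -> set Sigma).
Hypotheses (eS : locally_euclidean R 2 Sigma) (hS : hausdorff_space Sigma).
Hypotheses (bS : countable_base_on [set: Sigma]) (cA : countable A).
Hypotheses (dA : dense A) (hZ : hausdorff_space Z) (cZ : connected [set: Z]).
Hypotheses (qcont : continuous q) (qA : forall z, ~ A (q z)).
Hypothesis qopen : forall O, open O -> exists2 O', open O' & q @` O = O' `\` A.
Hypotheses (cD : countable D) (covD : forall z, exists2 V, D V & V z).
Hypothesis DW : forall V, D V -> sheet A q V (W V).

Local Notation T := (germ_space q D W).
Local Notation chart := (@germ_chart Sigma Z q D W).

Let openTP (G : set T) : open G = germ_open G. Proof. by []. Qed.

Let chart_surj V x : D V -> W V x -> exists2 s, chart V s & base_pt s = x.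
Proof.
move=> DV Wx.
by exists (GermPoint (ex_intro _ V (And3 DV Wx (erefl (germ q V x))))).
Qed.

Let chart_cov s : exists2 V, D V & chart V s.
Proof. by have [V [DV Vs gs]] := germ_spaceP s; exists V. Qed.

(** Two sheets with equal germs at one point have equal germs at all nearby base points, so charts
    overlap in open sets. *)
Let chart_open V N : D V -> open N -> open (chart V `&` base_pt @^-1` N).
Proof.
move=> DV oN; rewrite openTP => V' s DV' [[Ws gs] Ns] [W's g's].
have [M [oM Ms VV']] : exists M, [/\ open M, M (base_pt s) &
    V `&` q @^-1` M = V' `&` q @^-1` M].
  by apply/germ_eqP; rewrite -gs -g's.
have [_ oW _ _] := DW DV.
exists (N `&` M `&` W V); split=> //; first by do 2!apply: openI => //.
move=> t [[W't g't] [[Nt Mt] Wt]]; split=> //; split=> //.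
by rewrite g't; apply/germ_eqP; exists M.
Qed.

Let base_pt_open N : open N -> open ((base_pt : T -> Sigma) @^-1` N).
Proof.
by move=> oN; rewrite openTP => V s DV Ns Vs; exists N; split=> // t [].
Qed.

Let chart_patch V s0 : D V -> chart V s0 ->
  exists g, open_patch (chart V) (W V) base_pt g.
Proof.
move=> DV Vs0.
have /choice[g gP] x : exists s, W V x -> chart V s /\ base_pt s = x.
  have [Wx|] := pselect (W V x); last by exists s0.
  by have [s Vs sx] := chart_surj DV Wx; exists s.
have [_ oW _ _] := DW DV.
exists g; split=> //.
- by have := chart_open DV openT; rewrite preimage_setT setIT.
- move=> s Vs; have Ws := Vs.1; have [Vg gs] := gP _ Ws.
  by split=> //; exact: germ_chart_inj Vg Vs gs.
- by move=> O oO; exact: chart_open.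
- move=> O oO; apply: open_local => x [Wx Ogx]; have [Vg gx] := gP _ Wx.
  rewrite openTP in oO; have [N [oN Ngx NO]] := oO V (g x) DV Ogx Vg.
  exists (N `&` W V); split; first exact: openI.
    by split=> //; rewrite -gx.
  move=> y [Ny Wy]; have [Vgy gy] := gP _ Wy; split=> //; apply: NO.
  by split=> //=; rewrite gy.
Qed.

Let sheet_section V x : D V -> W V x -> ~ A x -> exists2 z, V z & q z = x.
Proof.
move=> DV Wx Ax; have [_ _ _ qV] := DW DV.
by have : (W V `\` A) x by []; rewrite -qV => -[z Vz <-]; exists z.
Qed.

Let sheet_W V z : D V -> V z -> W V (q z).
Proof.
move=> DV Vz; have [_ _ _ qV] := DW DV.
by have : (q @` V) (q z) by [exists z]; rewrite qV => -[].
Qed.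

(** On [V] the map [q] is injective, continuous and open relative to the complement of [A], so the
    traces of neighbourhoods of [q z] form a neighbourhood base at [z]. *)
Let germ_nbhs V z : D V -> V z -> germ q V (q z) = nbhs z.
Proof.
move=> DV Vz; have [oV oW injV qV] := DW DV; apply/seteqP; split=> P.
  move=> [N [oN Nz NP]]; apply: filterS NP _; apply: open_nbhs_nbhs; split=> //.
  by apply: openI => //; move/continuousP: qcont; exact.
move=> /open_nbhsP[G [oG Gz GP]]; have [ O oO qGV] := qopen (openI oV oG).
exists O; split=> //.
  have : (q @` (V `&` G)) (q z) by exists z.
  by rewrite qGV => -[].
move=> y [Vy Oy]; apply: GP.
have : (O `\` A) (q y) by split=> //; exact: qA.
by rewrite -qGV => -[y' [Vy' Gy'] /injV <-].
Qed.

(** Distinct base points are separated in [Sigma]. Over a common base point, the two sections are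
    compared on a neighbourhood that is connected off [A]: if they agree once they agree throughout
    and the germs are equal; if they never agree, the charts over it are disjoint. *)
Lemma germ_space_hausdorff : hausdorff_space T.
Proof.
rewrite open_hausdorff => s t st.
have [bst|bst] := pselect (base_pt s = base_pt t); last first.
  move: hS; rewrite open_hausdorff => /(_ _ _ (introN eqP bst)).
  move=> [[N M] /= [/[1!inE] Ns /[1!inE] Mt] [oN oM /eqP NM]].
  exists (base_pt @^-1` N, base_pt @^-1` M); rewrite /= ?inE //.
  split; [exact: base_pt_open|exact: base_pt_open|].
  by rewrite -preimage_setI NM preimage_set0.
have [V DV Vs] := chart_cov s; have [V' DV' V't] := chart_cov t.
have [oV oW injV qV] := DW DV; have [oV' oW' injV' qV'] := DW DV'.
have [B [oB Bs BW cB [b0 Bb0]]] := connected_nbhs_setD_countable eS cA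
  (openI oW oW') (conj Vs.1 (eq_ind_r (W V') V't.1 bst)).
have [|nagree] :=
  pselect (exists b, (B `\` A) b /\ exists2 z, (V `&` V') z & q z = b).
  move=> [b [Bb [z VV'z qz]]]; exfalso; move/eqP: st; apply.
  apply: germ_space_eq => //; rewrite Vs.2 V't.2 -bst; apply/germ_eqP.
  exists B; split=> //.
  have [G oG qG] := qopen (openI oV oV').
  (* Off [A], the sections agree exactly over [G]; [H] is the largest open set over which they
     differ, and it contains each point of disagreement in [B] off [A] because [Z] is Hausdorff. *)
  pose H := \bigcup_(M in [set M | open M /\
    forall z z', V z -> V' z' -> q z = q z' -> M (q z) -> z <> z']) M.
  have agree : B `\` A `<=` G.
    apply: ((connected_openP _).1 cB G H) => //.
    - by apply: bigcup_open => M [].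
    - move=> y [By Ay]; have [Wy W'y] := BW y By.
      have [u Vu qu] := sheet_section DV Wy Ay.
      have [u' V'u' qu'] := sheet_section DV' W'y Ay.
      have [uu'|uu'] := pselect (u = u').
        left; have : (q @` (V `&` V')) y.
          by exists u => //; split=> //; rewrite uu'.
        by rewrite qG => -[].
      right; move: hZ; rewrite open_hausdorff => /(_ _ _ (introN eqP uu')).
      move=> [[N M] /= [/[1!inE] Nu /[1!inE] Mu'] [oN oM /eqP NM]].
      have [N' oN' qN] := qopen (openI oN oV).
      have [M' oM' qM] := qopen (openI oM oV').
      exists (N' `&` M').
        split=> [|v v' Vv V'v' qvv' [N'v M'v] vv']; first exact: openI.
        have : (N' `\` A) (q v) by split=> //; exact: qA.
        rewrite -qN => -[w [Nw Vw] /injV wv].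
        have : (M' `\` A) (q v) by split=> //; exact: qA.
        rewrite -qM => -[w' [Mw' Vw']]; rewrite qvv' => /injV' w'v.
        suff : (N `&` M) v by rewrite NM.
        split; first by rewrite -wv.
        by rewrite vv' -w'v.
      have : (q @` (N `&` V)) y by exists u.
      have : (q @` (M `&` V')) y by exists u'.
      by rewrite qN qM => -[? _] [? _].
    - move=> y [By Ay] Gy [M [_ MP] My].
      have : (G `\` A) y by [].
      rewrite -qG => -[w [Vw V'w] qw].
      by apply: (MP w w) => //; rewrite qw.
    - exists b; split=> //.
      have : (q @` (V `&` V')) b by exists z.
      by rewrite qG => -[].
  have lift u : B (q u) -> exists2 w, (V `&` V') w & q w = q u.
    move=> Bu; have : (G `\` A) (q u).
      by split; [apply: agree; split=> //; exact: qA|exact: qA].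
    by rewrite -qG.
  apply/seteqP; split=> u [Vu /[dup] Bu /lift[w [Vw V'w] wu]]; split=> //.
    by rewrite -(injV w u).
  by rewrite -(injV' w u).
(* A germ common to both charts would make the sheets share a point over some nearby point of [B]
   off [A], against [nagree]. *)
exists (chart V `&` base_pt @^-1` B, chart V' `&` base_pt @^-1` B).
  by rewrite /= !inE; split; split=> //=; rewrite -bst.
split; [exact: chart_open|exact: chart_open|apply/eqP/seteqP; split=> // r].
move=> [[[Wr gr] Br] [[W'r g'r] _]]; apply: nagree.
have [M [oM Mr VV']] : exists M, [/\ open M, M (base_pt r) &
    V `&` q @^-1` M = V' `&` q @^-1` M].
  by apply/germ_eqP; rewrite -gr -g'r.
have [|y [[By My] Ay]] := setD_countable_neq0 eS cA (openI oB oM).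
  by exists (base_pt r).
have [Wy _] := BW y By; have [u Vu qu] := sheet_section DV Wy Ay.
exists y; split=> //; exists u => //; split=> //.
have : (V `&` q @^-1` M) u by split=> //=; rewrite qu.
by rewrite VV' => -[].
Qed.

Lemma germ_space_euclidean : locally_euclidean R 2 T.
Proof.
apply/locally_euclideanP => s; have [V DV Vs] := chart_cov s.
have [g P] := chart_patch DV Vs.
have /locally_euclideanP/(_ (base_pt s))[U [ O [f [h [Us Q]]]]] := eS.
by have PQ := open_patch_comp P Q; do 4 eexists; split; last exact: PQ.
Qed.

Lemma germ_space_countable_base : countable_base_on [set: T].
Proof.
apply: (@countable_base_on_sub _ _ (\bigcup_(V in D) chart V)).
  by move=> s _; have [V DV Vs] := chart_cov s; exists V.
apply: countable_base_on_bigcup => // V DV.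
have [[s Vs]|/set0P/negP] := pselect (chart V !=set0); last first.
  rewrite negbK => /eqP ->; exists set0; first exact: countable0.
  by split.
have [g P] := chart_patch DV Vs; apply: (open_patch_countable_base P).
exact: countable_base_on_sub bS.
Qed.

Lemma germ_space_surface : surface R T.
Proof.
split; last exact: germ_space_euclidean.
apply: second_countable_paracompact.
- exact: germ_space_hausdorff.
- exact: germ_space_countable_base.
- exact: locally_euclidean_regular germ_space_euclidean germ_space_hausdorff.
Qed.

Let added := [set s : T | A (base_pt s)].

Let added_countable : countable added.
Proof.
apply: (@sub_countable _ _ _ (\bigcup_(V in D) (chart V `&` added))).
  apply: subset_card_le => s As; have [V DV Vs] := chart_cov s.
  by exists V.
apply: bigcup_countable => // V DV; move/countable_injP: cA => [f injf].
apply/countable_injP; exists (f \o base_pt) => s t.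
rewrite !inE => -[Vs As] [Vt At] /injf; rewrite !inE => /(_ As At).
exact: germ_chart_inj Vs Vt.
Qed.

(** Reads an open set of germs on a chart as an open set of [Sigma], so that density and continuity
    are checked downstairs. *)
Let chart_shadow V G : D V -> open G ->
  exists2 O, open O & forall s, chart V s -> (G s <-> O (base_pt s)).
Proof.
move=> DV oG.
have [[s Vs]|V0] := pselect (chart V !=set0); last first.
  by exists set0; [exact: open0|move=> s Vs; case: V0; exists s].
have [g P] := chart_patch DV Vs.
exists (W V `&` g @^-1` G); first exact: patch_g_open P _ oG.
move=> t Vt; have [Wt gt] := patch_fP P Vt; split=> [Gt|[_ /=]].
  by split=> //=; rewrite gt.
by rewrite gt.
Qed.

Let added_dense : dense added.
Proof.
move=> G [s Gs] oG; have [V DV Vs] := chart_cov s.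
have [ O oO GO] := chart_shadow DV oG; have [_ oW _ _] := DW DV.
have [||x [[Wx Ox] Ax]] := dA (O := W V `&` O); last 1 first.
- have [t Vt tx] := chart_surj DV Wx; exists t; split.
    by apply/(GO t Vt); rewrite tx.
  by rewrite /added /= tx.
- by exists (base_pt s); split; [exact: Vs.1|apply/(GO s Vs)].
- exact: openI.
Qed.

(** A point of [Z] is sent to its own neighbourhood filter, so the embedding depends on no choice of
    sheet. *)
Let emb_proof z : exists V,
  [/\ D V, W V (q z) & (nbhs z : set (set Z)) = germ q V (q z)].
Proof.
have [V DV Vz] := covD z; exists V; split=> //; first exact: sheet_W.
by rewrite germ_nbhs.
Qed.

Let emb z : T := GermPoint (emb_proof z).

Let emb_chart V z : D V -> V z -> chart V (emb z).
Proof. by move=> DV Vz; split; [exact: sheet_W|rewrite /= germ_nbhs]. Qed.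

Let emb_continuous : continuous emb.
Proof.
apply/continuousP => G oG; apply: open_local => z Gz.
have [V DV Vz] := covD z; have [ O oO GO] := chart_shadow DV oG.
have [oV _ _ _] := DW DV.
exists (V `&` q @^-1` O); split.
- by apply: openI => //; move/continuousP: qcont; exact.
- by split=> //; apply/(GO _ (emb_chart DV Vz)).
- by move=> y [Vy Oy]; apply/(GO _ (emb_chart DV Vy)).
Qed.

Let emb_surj s : ~ added s -> exists z, emb z = s.
Proof.
move=> As; have [V DV [Ws gs]] := chart_cov s.
have [z Vz qz] := sheet_section DV Ws As.
by exists z; apply: germ_space_eq => //=; rewrite gs -qz germ_nbhs.
Qed.

(** In a Hausdorff space the neighbourhood filter determines the point. *)
Let emb_inj : injective emb.
Proof.
move=> y z [qyz nyz]; apply: hZ => P Q yP zQ.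
rewrite -nyz in zQ.
have [x [Px Qx]] : (P `&` Q) !=set0 by exists y; split; exact: nbhs_singleton.
by exists x.
Qed.

(** The image of [Z] is connected, and it is dense because nonempty open sets of [Sigma] are not
    contained in [A]. *)
Lemma germ_space_connected : connected [set: T].
Proof.
apply: (@connected_between _ (range emb)) => //.
  by apply: connected_continuous_connected => //; exact: continuous_subspaceT.
move=> s _ N /open_nbhsP[G [oG Gs GN]]; have [V DV Vs] := chart_cov s.
have [ O oO GO] := chart_shadow DV oG; have [_ oW _ _] := DW DV.
have [|x [[Wx Ox] Ax]] := setD_countable_neq0 eS cA (openI oW oO).
  by exists (base_pt s); split; [exact: Vs.1|apply/(GO s Vs)].
have [z Vz qz] := sheet_section DV Wx Ax.
exists (emb z); split; first by exists z.
by apply: GN; apply/(GO _ (emb_chart DV Vz)); rewrite /= qz.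
Qed.

Lemma germ_space_perforation : homeomorphic Z (set_type (~` added)).
Proof.
have embP z : emb z \in ~` added by rewrite inE; exact: qA.
have /choice[k kP] (s : set_type (~` added)) : exists z, emb z = set_val s.
  by apply: emb_surj; exact: (set_valP s).
exists (fun z => SigSub (embP z)); split.
  apply/continuousP => G [ O oO <-].
  by have /continuousP/(_ O oO) := emb_continuous.
exists k; last first.
  split=> [z|s]; first by apply: emb_inj; rewrite kP.
  by apply: val_inj; rewrite /= kP.
apply/continuousP => G oG.
(* The germs to which [G] belongs form an open set; at an embedded point this says that [G] is a
   neighbourhood, that is, contains the point. *)
exists [set s | germ_at s G].
  rewrite openTP => V s DV Gs [Ws gs].
  move: Gs; rewrite /= gs => -[N [oN Ns NG]].
  exists N; split=> // t [[Wt gt] Nt].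
  by rewrite /= gt; exists N.
apply/seteqP; split=> s /=; rewrite -kP /=; first exact: nbhs_singleton.
by move=> Gk; apply: open_nbhs_nbhs.
Qed.

Lemma germ_space_perforated : perforated_surface R Z.
Proof.
exists T, added; split.
- exact: germ_space_surface.
- exact: germ_space_connected.
- exact: added_countable.
- exact: added_dense.
- exact: germ_space_perforation.
Qed.

End completion.

(** * Coverings of a perforated space *)

Section covering.
Variables (Sigma Z : topologicalType) (A : set Sigma).
Variable p : Z -> set_type (~` A).
Hypotheses (pP : covering_projection p) (hS : hausdorff_space Sigma).

Let q (z : Z) : Sigma := set_val (p z).

(** Even covering in terms of [Sigma] alone; the condition on images of open sets keeps the
    continuity of the inverse homeomorphisms. *)
Definition evenly_covered_by (W : set Sigma) (S : set (set Z)) : Prop :=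
  [/\ forall V, S V -> sheet A q V W /\
        forall O, open O -> exists2 O', open O' & q @` (O `&` V) = O' `\` A,
      trivIset S id & q @^-1` W = \bigcup_(V in S) V].

Lemma covering_even x : ~ A x ->
  exists W S, [/\ open W, W x & evenly_covered_by W S].
Proof.
move=> Ax; pose b0 : set_type (~` A) := SigSub (mem_set (Ax : (~` A) x)).
have [_ /(_ b0)[U [[W oW <-] Wx [S [SP tS pS]]]]] := pP.
exists W, S; split=> //; split=> // V /SP[oV [h [ch [k ck [hk kh]]] hp]].
have qV : q @` V = W `\` A.
  apply/seteqP; split=> [_ [z Vz <-]|y [Wy Ay]].
    split; last exact: (set_valP (p z)).
    pose v : set_type V := SigSub (mem_set Vz).
    have -> : q z = set_val (set_val (h v)) by rewrite hp.
    exact: (set_valP (h v)).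
  pose b : set_type (~` A) := SigSub (mem_set (Ay : (~` A) y)).
  have Ub : (set_val @^-1` W) b by [].
  pose u : set_type (set_val @^-1` W) := SigSub (mem_set Ub).
  exists (set_val (k u)); first exact: set_valP.
  by rewrite /q -hp kh.
have injV y z : V y -> V z -> q y = q z -> y = z.
  move=> Vy Vz /val_inj pyz.
  have : h (SigSub (mem_set Vy)) = h (SigSub (mem_set Vz)).
    by apply: val_inj; rewrite [LHS]hp [RHS]hp.
  by move=> /(can_inj hk)/(congr1 set_val).
split=> [//|O oO].
have /continuousP/(_ (set_val @^-1` O))[|O1 [ O2 oO2 <-] O12] := ck.
  by exists O.
exists (O2 `&` W); first exact: openI.
apply/seteqP; split=> [_ [z [ Oz Vz] <-]|y [[ O2y Wy] Ay]].
  have : (W `\` A) (q z) by rewrite -qV; exists z.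
  move=> [Wq Aq]; split=> //; split=> //.
  pose v : set_type V := SigSub (mem_set Vz).
  have : (k @^-1` (set_val @^-1` O)) (h v) by rewrite /= hk.
  by rewrite -O12 /= hp.
have : (W `\` A) y by [].
rewrite -qV => -[z Vz qz]; exists z => //; split=> //.
pose v : set_type V := SigSub (mem_set Vz).
have : (set_val @^-1` (set_val @^-1` O2)) (h v).
  by rewrite /= hp -[set_val _]/(q z) qz.
by rewrite O12 /= hk.
Qed.

Lemma covering_even_pt z : exists W S V,
  [/\ open W, evenly_covered_by W S, S V & V z].
Proof.
have Aq : ~ A (q z) by exact: (set_valP (p z)).
have [W [S [oW Wq eW]]] := covering_even Aq.
have [V SV Vz] : (\bigcup_(V in S) V) z by case: eW => _ _ <-.
by exists W, S, V.
Qed.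

Lemma covering_continuous : continuous q.
Proof.
apply/continuousP => O oO; have [/continuousP cp _] := pP.
by apply: (cp (set_val @^-1` O)); exists O.
Qed.

Lemma covering_open O : open O -> exists2 O', open O' & q @` O = O' `\` A.
Proof.
move=> oO.
(* Taking the union of all admissible open sets avoids choosing one for each sheet. *)
exists (\bigcup_(N in [set N | open N /\ N `\` A `<=` q @` O]) N).
  by apply: bigcup_open => N [].
apply/seteqP; split=> [_ [z Oz <-]|y [[N [_ NO] Ny] Ay]]; last exact: NO.
split; last exact: (set_valP (p z)).
have [W [S [V [oW [SP _ _] SV Vz]]]] := covering_even_pt z.
have [ O' oO' qO] := (SP V SV).2 O oO.
exists O'; first by split=> // y; rewrite -qO => -[w [ Ow _] <-]; exists w.
have : (q @` (O `&` V)) (q z) by exists z.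
by rewrite qO => -[].
Qed.

(** Two points of one fibre lie in sheets over the same [W]; these sheets are distinct by
    injectivity, hence disjoint. *)
Lemma covering_hausdorff : hausdorff_space Z.
Proof.
rewrite open_hausdorff => y z yz.
have [qyz|qyz] := pselect (q y = q z); last first.
  move: hS; rewrite open_hausdorff => /(_ _ _ (introN eqP qyz)).
  move=> [[N M] /= [/[1!inE] Ny /[1!inE] Mz] [oN oM /eqP NM]].
  have /continuousP cq := covering_continuous.
  exists (q @^-1` N, q @^-1` M); rewrite /= ?inE //.
  split; [exact: cq|exact: cq|].
  by rewrite -preimage_setI NM preimage_set0.
have [W [S [V [oW [SP tS qW] SV Vy]]]] := covering_even_pt y.
have [V' SV' V'z] : (\bigcup_(V in S) V) z.
  rewrite -qW /= -qyz; have [[_ _ _ qV] _] := SP V SV.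
  by have : (q @` V) (q y) by [exists y]; rewrite qV => -[].
have [[oV _ injV _] _] := SP V SV; have [[oV' _ _ _] _] := SP V' SV'.
exists (V, V'); rewrite /= ?inE //; split=> //.
apply: contrapT => /eqP/set0P VV'.
move: V'z; rewrite -(tS V V' SV SV' VV') => Vz.
by move/eqP: yz; apply; exact: injV.
Qed.

(** Every sheet over [W] meets the fibre in exactly one point. *)
Lemma covering_fiber_card W S x : evenly_covered_by W S -> W x -> ~ A x ->
  q @^-1` [set x] #= S.
Proof.
move=> [SP tS qW] Wx Ax.
have /choice[f fP] z : exists V, q z = x -> S V /\ V z.
  have [qz|] := pselect (q z = x); last by exists set0.
  have [V SV Vz] : (\bigcup_(V in S) V) z by rewrite -qW /= qz.
  by exists V.
have -> : S = f @` (q @^-1` [set x]).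
  apply/seteqP; split=> [V SV|_ [z qz <-]]; last exact: (fP z qz).1.
  have [[_ _ _ qV] _] := SP V SV.
  have : (W `\` A) x by [].
  rewrite -qV => -[z Vz qz]; exists z => //; have [Sf fz] := fP z qz.
  by apply: tS => //; exists z.
apply/card_esym/inj_card_eq => y z; rewrite !inE => qy qz fyz.
have [Sf fy] := fP y qy; have [_ fz] := fP z qz.
have [[_ _ injf _] _] := SP _ Sf.
by apply: injf => //; [rewrite fyz|rewrite qy qz].
Qed.

(** The cardinality of the fibre is locally constant, being that of the family of sheets. *)
Lemma covering_fiber_const x y : connected (~` A) -> ~ A x -> ~ A y ->
  q @^-1` [set x] #= q @^-1` [set y].
Proof.
move=> cA Ax Ay.
pose E (P : set (set Z) -> Prop) :=
  \bigcup_(W in [set W | open W /\ exists2 S, evenly_covered_by W S & P S]) W.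
have oE P : open (E P) by apply: bigcup_open => W [].
pose same := [set S : set (set Z) | q @^-1` [set x] #= S].
suff /(_ y Ay)[W [_ [S eW sS]] Wy] : ~` A `<=` E same.
  apply: card_eq_trans sS _; apply: card_esym.
  exact: covering_fiber_card Wy Ay.
apply: ((connected_openP _).1 cA _ (E (~` same))) => //.
- move=> z /covering_even[W [S [oW Wz eW]]].
  have [sS|nS] := pselect (same S); [left|right]; exists W => //.
    by split=> //; exists S.
  by split=> //; exists S.
- move=> z Az [W [_ [S eW sS]] Wz] [W' [_ [S' eW' +]] W'z]; apply.
  apply: (card_eq_trans sS).
  apply: (card_eq_trans (card_esym (covering_fiber_card eW Wz Az))).
  exact: covering_fiber_card W'z Az.
- exists x; split=> //; have [W [S [oW Wx eW]]] := covering_even Ax.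
  exists W => //; split=> //; exists S => //.
  exact: covering_fiber_card Wx Ax.
Qed.

(** Fix a sheet [U] and an evenly covered [M]. The sheets over [M] that meet [U] are disjoint, and
    [q] is injective on [U], so their traces on [U] have disjoint images. Each image contains a
    nonempty basic set minus [A], so there are countably many such sheets. *)
Lemma covering_countable_sheets :
  countable_base_on [set: Sigma] -> connected [set: Z] ->
  exists D : set (set Z), exists W : set Z -> set Sigma,
    [/\ countable D, forall z, exists2 V, D V & V z
      & forall V, D V -> sheet A q V (W V)].
Proof.
move=> bS cZ.
pose C := [set W : set Sigma | open W /\ exists S, evenly_covered_by W S].
have [C' [C'C cC' covC']] := @lindelof Sigma C bS (fun W CW => proj1 CW).
have /choice[S SP] W : exists S, C' W -> evenly_covered_by W S.
  have [/C'C[_ [S eW]]|] := pselect (C' W); last by exists set0.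
  by exists S.
pose D := [set V : set Z | V !=set0 /\ exists2 W, C' W & S W V].
have /choice[W WP] V : exists W, D V -> C' W /\ S W V.
  have [[_ [W C'W SV]]|] := pselect (D V); last by exists set0.
  by exists W.
have DW V : D V -> sheet A q V (W V).
  by move=> /WP[/SP[eW _ _] /eW[]].
have covD z : exists2 V, D V & V z.
  have Aq : ~ A (q z) by exact: (set_valP (p z)).
  have [W0 [S0 [oW0 W0q eW0]]] := covering_even Aq.
  have [|W1 C'W1 W1q] := covC' (q z).
    by exists W0 => //; split=> //; exists S0.
  have [V SV Vz] : (\bigcup_(V in S W1) V) z by have [_ _ <-] := SP _ C'W1.
  by exists V => //; split; [exists z|exists W1].
exists D, W; split=> //.
apply: (countable_connected_cover cZ) => // [U DU|U DU].
  by have [oU _ _ _] := DW U DU; split=> //; case: DU.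
apply: (@sub_countable _ _ _
    (\bigcup_(M in C') [set V | S M V /\ V `&` U !=set0])).
  apply: subset_card_le => V [[_ [M C'M SV]] VU].
  by exists M.
apply: bigcup_countable => // M C'M.
have [SM tM _] := SP M C'M; have [B cB [oB BP]] := bS.
have [oU _ injU _] := DW U DU.
have /choice[b bP] V : exists b, S M V /\ V `&` U !=set0 ->
    [/\ B b, b `\` A !=set0 & b `\` A `<=` q @` (V `&` U)].
  have [[SV [z [Vz Uz]]]|] := pselect (S M V /\ V `&` U !=set0);
    last by exists set0.
  have [[oV _ _ _] _] := SM V SV.
  have [ O oO qO] := covering_open (openI oV oU).
  have : (q @` (V `&` U)) (q z) by exists z.
  rewrite qO => -[ Oq Aq]; have [b [Bb bq bO]] := BP _ _ I oO Oq.
  by exists b => _; split=> //; [exists (q z)|move=> y [/bO]].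
move/countable_injP: cB => [f injf].
apply/countable_injP; exists (f \o b) => V V'; rewrite !inE => VP V'P /=.
have [Bb [y bfy] bV] := bP V VP; have [Bb' _ bV'] := bP V' V'P.
move=> /injf; rewrite !inE => /(_ Bb Bb') bb'.
have [u [Vu Uu] qu] := bV y bfy; rewrite bb' in bfy.
(* If [V] and [V'] get the same basic set, the point of [U] over [y] lies in both, and disjointness
   gives [V = V']. *)
have [u' [V'u' Uu'] qu'] := bV' y bfy.
have uu' : u = u' by apply: injU => //; rewrite qu qu'.
by apply: tM; [exact: VP.1|exact: V'P.1|exists u; split=> //; rewrite uu'].
Qed.

End covering.

(** * Degree and perforation for a path connected covering space *)

Lemma path_connected_connected (R : realType) (X : topologicalType) :
  path_connected R X -> connected [set: X].
Proof.
move=> pX.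
have [[x0 _]|/set0P/negP] := pselect ([set: X] !=set0); last first.
  by rewrite negbK => /eqP ->; exact: connected0.
have -> : [set: X] = \bigcup_(C in [set C | connected C /\ C x0]) C.
  apply/seteqP; split=> // x _; have [g [cg g0 g1]] := pX x0 x.
  exists (g @` `[0%R, 1%R]%classic).
    split.
      by apply: connected_continuous_connected cg; exact: segment_connected.
    by exists 0%R => //; rewrite /= in_itv /= lexx ler01.
  by exists 1%R => //; rewrite /= in_itv /= lexx ler01.
by apply: bigcup_connected => [|C []//]; exists x0 => C [].
Qed.

Theorem proposition3p3 (R : realType) (Sigma : topologicalType)
    (Sigma_surface : surface R Sigma) (Sigma_connected : connected [set: Sigma])
    (A : set Sigma) (A_countable : countable A) (A_dense : dense A)
    (Z : topologicalType) (p : Z -> set_type (~` A))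
    (p_covering : covering_projection p) (Z_connected : path_connected R Z) :
  ((exists n : nat, has_degree p `I_n) \/ has_degree p [set: nat]) /\
  perforated_surface R Z.
Proof.
have [pS eS] := Sigma_surface; have hS := pS.1.
have bS := paracompact_connected_countable_base eS pS Sigma_connected.
have cZ := path_connected_connected Z_connected.
have [D [W [cD covD DW]]] := covering_countable_sheets p_covering bS cZ.
split; last first.
  apply: (germ_space_perforated eS hS bS A_countable A_dense _ cZ _ _ _ cD
    covD DW).
  - exact: covering_hausdorff p_covering hS.
  - exact: covering_continuous.
  - by move=> z; exact: (set_valP (p z)).
  - exact: covering_open.
have cA := connected_setC_countable eS A_countable Sigma_connected.
have fibE b : p @^-1` [set b] = (fun z => set_val (p z)) @^-1` [set set_val b].
  by apply/seteqP; split=> z /=; [move=> ->|exact: val_inj].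
(* If [A] is all of [Sigma] the base is empty, and degree 0 holds vacuously. *)
have [[x Ax]|noA] := pselect (exists x, ~ A x); last first.
  by left; exists 0%N => b; case: noA; exists (set_val b); exact: (set_valP b).
pose F := (fun z => set_val (p z)) @^-1` [set x].
have degF (T : Type) (E : set T) : F #= E -> has_degree p E.
  move=> FE b; rewrite fibE; apply: card_eq_trans FE.
  by apply: (covering_fiber_const p_covering cA) => //; exact: (set_valP b).
have [/finite_setP[n Fn]|infF] := pselect (finite_set F).
  by left; exists n; exact: degF.
right; apply: degF; apply: eq_card_nat => //.
(* It remains to see that [F] is countable: sending a point to a chosen sheet through it is
   injective on a fibre. *)
have /choice[s sP] z : exists V, D V /\ V z by have [V] := covD z; exists V.
move/countable_injP: cD => [f injf]; apply/countable_injP.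
exists (f \o s) => y z; rewrite !inE => Fy Fz /= /injf; rewrite !inE.
move=> /(_ (sP y).1 (sP z).1) syz; have [_ _ injV _] := DW _ (sP y).1.
apply: injV; [exact: (sP y).2|rewrite syz; exact: (sP z).2|].
exact: (eq_trans Fy (esym Fz)).
Qed.
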